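(* Let $a,b$ be real numbers such that $b^2-a^2=1$ and $ab\neq0$. Let $M^2_1$ be the complex circle in $\mathbb{H}^3_1\subset\mathbb{R}^4_2$ parametrized by $$x(s,t)=\big(b\cos s\cosh t-a\sin s\sinh t,\ \ a\cos s\sinh t+b\sin s\cosh t,\ \ a\cos s\cosh t+b\sin s\sinh t,\ \ b\cos s\sinh t-a\sin s\cosh t\big).$$ Then $M^2_1$ is proper $r$-harmonic provided that either (1) $r>2$ and $a^2=\frac{\sqrt2}{2}-\frac12$, $b^2=\frac{\sqrt2}{2}+\frac12$; or (2) $r=3$ and $a^2=\frac{\sqrt3}{3}-\frac12$, $b^2=\frac{\sqrt3}{3}+\frac12$.
   Context: $\mathbb{R}^4_2$ is $\mathbb{R}^4$ with $\langle x,y\rangle=-x_1y_1-x_2y_2+x_3y_3+x_4y_4$, and $\mathbb{H}^3_1=\{x\in\mathbb{R}^4_2:\langle x,x\rangle=-1\}$ with the induced metric (index $1$, constant sectional curvature $-1$). The curvature convention on $\mathbb{H}^3_1$ is $R(X,Y)Z=-(\langle Y,Z\rangle X-\langle X,Z\rangle Y)$. The lower index in $M^2_1$ is the index of the induced metric. For a surface $\varphi:M\to N$ with nondegenerate induced metric, unit normal $\eta$, $\varepsilon=\langle\eta,\eta\rangle=\pm1$ and shape operator $A(X)=-\nabla^N_X\eta$, the mean curvature function is $f=\frac12\varepsilon\operatorname{Tr}A$; the surface is minimal if $f\equiv0$. $r$-harmonicity. Let $\{e_i\}$ be a local orthonormal frame of $M$ with $\langle e_i,e_j\rangle=\varepsilon_i\delta_{ij}$.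 For a smooth map $\varphi:M\to N$ of pseudo-Riemannian manifolds, $\tau(\varphi)=\sum_i\varepsilon_i[\nabla^\varphi_{e_i}d\varphi(e_i)-d\varphi(\nabla^M_{e_i}e_i)]$ and $\overline\Delta=-\sum_i\varepsilon_i(\nabla^\varphi_{e_i}\nabla^\varphi_{e_i}-\nabla^\varphi_{\nabla^M_{e_i}e_i})$ on sections of $\varphi^{-1}TN$, where $\nabla^\varphi$ is the induced connection. With $\tau=\tau(\varphi)$ and summation over $i$ understood, for $s\geq1$, $$\tau_{2s}(\varphi)=\overline\Delta^{2s-1}\tau-\varepsilon_iR^N(\overline\Delta^{2s-2}\tau,d\varphi(e_i))d\varphi(e_i)-\sum_{\ell=1}^{s-1}\{\varepsilon_iR^N(\nabla^\varphi_{e_i}\overline\Delta^{s+\ell-2}\tau,\overline\Delta^{s-\ell-1}\tau)d\varphi(e_i)-\varepsilon_iR^N(\overline\Delta^{s+\ell-2}\tau,\nabla^\varphi_{e_i}\overline\Delta^{s-\ell-1}\tau)d\varphi(e_i)\},$$ $$\tau_{2s+1}(\varphi)=\overline\Delta^{2s}\tau-\varepsilon_iR^N(\overline\Delta^{2s-1}\tau,d\varphi(e_i))d\varphi(e_i)-\sum_{\ell=1}^{s-1}\{\varepsilon_iR^N(\nabla^\varphi_{e_i}\overline\Delta^{s+\ell-1}\tau,\overline\Delta^{s-\ell-1}\tau)d\varphi(e_i)-\varepsilon_iR^N(\overline\Delta^{s+\ell-1}\tau,\nabla^\varphi_{e_i}\overline\Delta^{s-\ell-1}\tau)d\varphi(e_i)\}-\varepsilon_iR^N(\nabla^\varphi_{e_i}\overline\Delta^{s-1}\tau,\overline\Delta^{s-1}\tau)d\varphi(e_i).$$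 $\varphi$ is $r$-harmonic if $\tau_r(\varphi)=0$ ($r\ge2$). A surface is $r$-harmonic if its isometric immersion is, and proper $r$-harmonic if in addition it is not minimal.
   Formalization: In case (1), r = 3 is excluded (so r > 3), because for those values of a and b one has τ_3 = 2τ ≠ 0 and the surface is not 3-harmonic. *)

(* Defs.v *)
From HB Require Import structures.
From mathcomp Require Import all_boot all_order all_algebra.
From mathcomp Require Import all_classical all_reals all_analysis.
Set Implicit Arguments. Unset Strict Implicit. Unset Printing Implicit Defensive.
Import Order.TTheory GRing.Theory Num.Theory.
Import numFieldNormedType.Exports.
Local Open Scope classical_set_scope.
Local Open Scope ring_scope.

Section Hyperbolic.
Context {R : realType}.
Implicit Type u : R.

Definition cosh u : R := (expR u + expR (- u)) / 2.
Definition sinh u : R := (expR u - expR (- u)) / 2.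

End Hyperbolic.

Section Smooth.
Context {R : realType} {n : nat} {V : normedModType R}.

(* f is of class C^(k.+1) on an open set when it is Frechet differentiable there
   and all its directional derivatives are of class C^k. *)
Fixpoint Ck_on (k : nat) (U : set 'rV[R]_n.+1) (f : 'rV[R]_n.+1 -> V) : Prop :=
  if k is k'.+1 then
    (forall p, U p -> differentiable f p) /\ (forall v, Ck_on k' U ('D_v f))
  else forall p, U p -> {for p, continuous f}.

Definition smooth_on (U : set 'rV[R]_n.+1) (f : 'rV[R]_n.+1 -> V) : Prop :=
  forall k, Ck_on k U f.

End Smooth.

(* The scalar product of R^4_2: the first two coordinates carry a minus sign. *)
Definition sdot {R : realType} (u v : 'rV[R]_4) : R :=
  \sum_(i < 4) (-1) ^+ (i < 2)%N * u 0 i * v 0 i.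

(* Curvature tensor of H^3_1 (constant sectional curvature -1). *)
Definition curvH {R : realType} (X Y Z : 'rV[R]_4) : 'rV[R]_4 :=
  - (sdot Y Z *: X - sdot X Z *: Y).

(* A surface in H^3_1 is given by a parametrization phi : R^2 -> R^4_2; tangent
   vectors and vector fields of M are written in the coordinates of R^2, and
   sections of phi^{-1} T H^3_1 are R^4-valued functions on R^2. *)
Section ParametrizedSurface.
Context {R : realType}.
Variable phi : 'rV[R]_2 -> 'rV[R]_4.
Implicit Types (p q X : 'rV[R]_2) (U : set 'rV[R]_2) (r s : nat).

Definition dphi p X : 'rV[R]_4 := 'D_X phi p.

Definition basis_vec (i : 'I_2) : 'rV[R]_2 := delta_mx 0 i.

Definition metric p X (Y : 'rV[R]_2) : R := sdot (dphi p X) (dphi p Y).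

Definition gram p : 'M[R]_2 := \matrix_(i, j) metric p (basis_vec i) (basis_vec j).

(* phi is an immersion into H^3_1 with nondegenerate induced metric of index 1:
   each tangent plane has an orthonormal basis with exactly one timelike vector. *)
Definition lorentzian_surface_in_H31 : Prop :=
  [/\ smooth_on setT phi,
      forall p, sdot (phi p) (phi p) = -1 &
      forall p, exists v w : 'rV[R]_2,
        [/\ metric p v v = -1, metric p w w = 1 & metric p v w = 0]].

(* Levi-Civita connection of the induced metric. *)
Definition christoffel p (i j k : 'I_2) : R :=
  2^-1 * \sum_l invmx (gram p) k l *
    (('D_(basis_vec i) (fun q => gram q j l) p : R)
     + ('D_(basis_vec j) (fun q => gram q i l) p : R)
     - ('D_(basis_vec l) (fun q => gram q i j) p : R)).

Definition nablaM X (Y : 'rV[R]_2 -> 'rV[R]_2) p : 'rV[R]_2 :=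
  ('D_X Y p : 'rV[R]_2) + \row_k \sum_i \sum_j christoffel p i j k * X 0 i * Y p 0 j.

(* Induced connection on phi^{-1} T H^3_1: the derivative in R^4 projected onto
   the tangent space of H^3_1, which is the orthogonal of phi p, where
   <phi p, phi p> = -1. *)
Definition nabla X (V : 'rV[R]_2 -> 'rV[R]_4) p : 'rV[R]_4 :=
  ('D_X V p : 'rV[R]_4) + sdot ('D_X V p) (phi p) *: phi p.

Section Frame.
Variables (eps : 'I_2 -> R) (e : 'I_2 -> 'rV[R]_2 -> 'rV[R]_2).
Implicit Type V : 'rV[R]_2 -> 'rV[R]_4.

Definition orthonormal_frame U : Prop :=
  [/\ forall i, eps i = 1 \/ eps i = -1,
      forall i, smooth_on U (e i) &
      forall p i j, U p -> metric p (e i p) (e j p) = if i == j then eps i else 0].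

Definition tension p : 'rV[R]_4 :=
  \sum_i eps i *: (nabla (e i p) (fun q => dphi q (e i q)) p
                   - dphi p (nablaM (e i p) (e i) p)).

Definition rough_laplacian V p : 'rV[R]_4 :=
  - \sum_i eps i *: (nabla (e i p) (fun q => nabla (e i q) V q) p
                     - nabla (nablaM (e i p) (e i) p) V p).

Definition lap_tension (k : nat) : 'rV[R]_2 -> 'rV[R]_4 :=
  iter k rough_laplacian tension.

Local Notation L := lap_tension.

Definition tau_even s p : 'rV[R]_4 :=
  L (2 * s - 1)%N p
  - \sum_i eps i *: curvH (L (2 * s - 2)%N p) (dphi p (e i p)) (dphi p (e i p))
  - \sum_(1 <= l < s)
      (\sum_i eps i *: curvH (nabla (e i p) (L (s + l - 2)%N) p)
                             (L (s - l - 1)%N p) (dphi p (e i p))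
       - \sum_i eps i *: curvH (L (s + l - 2)%N p)
                               (nabla (e i p) (L (s - l - 1)%N) p)
                               (dphi p (e i p))).

Definition tau_odd s p : 'rV[R]_4 :=
  L (2 * s)%N p
  - \sum_i eps i *: curvH (L (2 * s - 1)%N p) (dphi p (e i p)) (dphi p (e i p))
  - \sum_(1 <= l < s)
      (\sum_i eps i *: curvH (nabla (e i p) (L (s + l - 1)%N) p)
                             (L (s - l - 1)%N p) (dphi p (e i p))
       - \sum_i eps i *: curvH (L (s + l - 1)%N p)
                               (nabla (e i p) (L (s - l - 1)%N) p)
                               (dphi p (e i p)))
  - \sum_i eps i *: curvH (nabla (e i p) (L (s - 1)%N) p)
                          (L (s - 1)%N p) (dphi p (e i p)).

(* Meaningful for r >= 2 only. *)
Definition tau r p : 'rV[R]_4 :=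
  if odd r then tau_odd r./2 p else tau_even r./2 p.

End Frame.

Definition r_harmonic r : Prop :=
  forall U eps e, open U -> orthonormal_frame eps e U ->
    forall p, U p -> tau eps e r p = 0.

Definition unit_normal U (eta : 'rV[R]_2 -> 'rV[R]_4) (ep : R) : Prop :=
  [/\ smooth_on U eta,
      ep = 1 \/ ep = -1 &
      forall p, U p ->
        [/\ sdot (eta p) (phi p) = 0,
            forall X, sdot (eta p) (dphi p X) = 0 &
            sdot (eta p) (eta p) = ep]].

(* Coordinates c of a vector w tangent to M at phi p, i.e. w = dphi p c. *)
Definition tangent_coords p (w : 'rV[R]_4) : 'rV[R]_2 :=
  (\row_j sdot w (dphi p (basis_vec j))) *m invmx (gram p).

(* Matrix of the shape operator X |-> - nabla_X eta; its i-th row holds the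
   coordinates of the image of basis_vec i. *)
Definition shape_operator (eta : 'rV[R]_2 -> 'rV[R]_4) p : 'M[R]_2 :=
  \matrix_i tangent_coords p (- nabla (basis_vec i) eta p).

Definition mean_curvature (eta : 'rV[R]_2 -> 'rV[R]_4) (ep : R) p : R :=
  2^-1 * ep * \tr (shape_operator eta p).

Definition minimal : Prop :=
  forall U eta ep, open U -> unit_normal U eta ep ->
    forall p, U p -> mean_curvature eta ep p = 0.

Definition proper_r_harmonic r : Prop := r_harmonic r /\ ~ minimal.

End ParametrizedSurface.

(* p 0 0 and p 0 1 are the parameters s and t. *)
Definition complex_circle {R : realType} (a b : R) (p : 'rV[R]_2) : 'rV[R]_4 :=
  let s := p 0 0 in let t := p 0 1 in
  \row_(j < 4) [:: b * cos s * cosh t - a * sin s * sinh t;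
                   a * cos s * sinh t + b * sin s * cosh t;
                   a * cos s * cosh t + b * sin s * sinh t;
                   b * cos s * sinh t - a * sin s * cosh t]`_j.

(* Main.v *)
Require Import Defs.
From mathcomp Require Import all_boot all_order all_algebra.
From mathcomp Require Import all_classical all_reals all_analysis.
From mathcomp Require Import ring lra zify.
Local Open Scope ring_scope.

(** The parametrization phi is an orbit of a two-parameter group of linear maps
  of R^4: its partial derivatives in s and t are phi J and phi K for constant
  commuting matrices with J^2 = -1 and K^2 = 1, where J is an isometry and K an
  anti-isometry of R^4_2.  Put m = 2ab and D = 1 + m^2.  The Gram matrix
  [[-1, -m], [-m, 1]] is constant, so M is flat, and N = phi (JK + m) is normal
  with <N, N> = D.  On a section phi P whose derivatives phi J P and
  phi K P are orthogonal to phi, the rough Laplacian is -(2/D) times the tangential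
  projection to H^3_1 of phi (1 - m JK) P.  For P = 1 this gives the tension field
  tau = -(2m/D) N, and for P = JK + m it shows that N is an eigensection, with
  eigenvalue 2(m^2 - 1)/D.  In case (1), m^2 = 1, so the Laplacian of
  tau is zero and every term of tau_r with r > 3 vanishes; in case (2),
  m^2 = 1/3, the eigenvalue is -1 and tau_3 = (1 - 2 + 4m^2/D) tau = 0. *)

Set Implicit Arguments. Unset Strict Implicit. Unset Printing Implicit Defensive.
Import Order.TTheory GRing.Theory Num.Theory.
Import numFieldNormedType.Exports.
Local Open Scope classical_set_scope.

(** * Scalar product of R^4_2 and the two commuting generators *)

Section ScalarProduct.
Context {R : realType}.
Implicit Types u v w : 'rV[R]_4.

Lemma sum2E (W : nmodType) (F : 'I_2 -> W) : \sum_i F i = F 0 + F 1.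
Proof.
by rewrite !big_ord_recl big_ord0 addr0; congr (F _ + F _); apply: val_inj.
Qed.

Lemma sum4E (F : 'I_4 -> R) : \sum_i F i = F 0 + F 1 + F 2 + F 3.
Proof.
rewrite !big_ord_recl big_ord0 addr0 !addrA.
by congr (F _ + F _ + F _ + F _); apply: val_inj.
Qed.

Lemma row4_eq u v :
  u 0 0 = v 0 0 -> u 0 1 = v 0 1 -> u 0 2 = v 0 2 -> u 0 3 = v 0 3 -> u = v.
Proof.
move=> e0 e1 e2 e3; apply/rowP => -[[|[|[|[|//]]]] lti].
- by rewrite (_ : Ordinal lti = 0)//; apply: val_inj.
- by rewrite (_ : Ordinal lti = 1)//; apply: val_inj.
- by rewrite (_ : Ordinal lti = 2)//; apply: val_inj.
- by rewrite (_ : Ordinal lti = 3)//; apply: val_inj.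
Qed.

Lemma sdotE u v :
  sdot u v = - (u 0 0 * v 0 0) - u 0 1 * v 0 1 + u 0 2 * v 0 2 + u 0 3 * v 0 3.
Proof. by rewrite /sdot sum4E /= expr0 expr1 !mulN1r !mul1r !mulNr. Qed.

Lemma sdotC u v : sdot u v = sdot v u.
Proof. by rewrite !sdotE; ring. Qed.

Lemma sdotDl u v w : sdot (u + v) w = sdot u w + sdot v w.
Proof. by rewrite !sdotE !mxE; ring. Qed.

Lemma sdotZl c u w : sdot (c *: u) w = c * sdot u w.
Proof. by rewrite !sdotE !mxE; ring. Qed.

Lemma sdot0l w : sdot 0 w = 0.
Proof. by rewrite !sdotE !mxE; ring. Qed.

Lemma sdotDr u v w : sdot w (u + v) = sdot w u + sdot w v.
Proof. by rewrite ![sdot w _]sdotC sdotDl. Qed.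

Lemma sdotZr c u w : sdot w (c *: u) = c * sdot w u.
Proof. by rewrite ![sdot w _]sdotC sdotZl. Qed.

Lemma sdotNr u w : sdot w (- u) = - sdot w u.
Proof. by rewrite -scaleN1r sdotZr mulN1r. Qed.

Lemma sdotNl u w : sdot (- u) w = - sdot u w.
Proof. by rewrite sdotC sdotNr sdotC. Qed.

(* Right multiplication by mxJ (mxK) differentiates the parametrization
   with respect to s (t). *)
Definition mxJ : 'M[R]_4 :=
  \matrix_(i, j) (nth [::] [:: [:: 0; 1; 0; 0]; [:: -1; 0; 0; 0];
                               [:: 0; 0; 0; -1]; [:: 0; 0; 1; 0]] i)`_j.

Definition mxK : 'M[R]_4 := \matrix_(i, j) (i + j == 3)%N%:R.

Lemma mulmxJE u :
  u *m mxJ = \row_j [:: - u 0 1; u 0 0; u 0 3; - u 0 2]`_j.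
Proof. by apply: row4_eq; rewrite !mxE sum4E !mxE /=; ring. Qed.

Lemma mulmxKE u : u *m mxK = \row_j [:: u 0 3; u 0 2; u 0 1; u 0 0]`_j.
Proof. by apply: row4_eq; rewrite !mxE sum4E !mxE /=; ring. Qed.

Lemma mul_row_inj m (A B : 'M[R]_(4, m)) : (forall u, u *m A = u *m B) -> A = B.
Proof. by move=> AB; apply/row_matrixP => i; rewrite !rowE AB. Qed.

Lemma mxJJ : mxJ *m mxJ = - 1%:M.
Proof.
apply: mul_row_inj => u; rewrite mulmxA mulmxN mulmx1 !mulmxJE.
by apply: row4_eq; rewrite !mxE //= !mxE.
Qed.

Lemma mxKK : mxK *m mxK = 1%:M.
Proof.
apply: mul_row_inj => u; rewrite mulmxA mulmx1 !mulmxKE.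
by apply: row4_eq; rewrite !mxE.
Qed.

Lemma mxKJ : mxK *m mxJ = mxJ *m mxK.
Proof.
apply: mul_row_inj => u; rewrite !mulmxA !(mulmxKE, mulmxJE).
by apply: row4_eq; rewrite !mxE.
Qed.

Lemma sdotJJ u v : sdot (u *m mxJ) (v *m mxJ) = sdot u v.
Proof. by rewrite !sdotE !mulmxJE !mxE /=; ring. Qed.

Lemma sdotKK u v : sdot (u *m mxK) (v *m mxK) = - sdot u v.
Proof. by rewrite !sdotE !mulmxKE !mxE /=; ring. Qed.

(** With [sdotK]: both generators are skew-adjoint, so the group they generate preserves the scalar
    product. *)
Lemma sdotJ u v : sdot (u *m mxJ) v = - sdot u (v *m mxJ).
Proof. by rewrite !sdotE !mulmxJE !mxE /=; ring. Qed.

Lemma sdotK u v : sdot (u *m mxK) v = - sdot u (v *m mxK).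
Proof. by rewrite !sdotE !mulmxKE !mxE /=; ring. Qed.

End ScalarProduct.

(** * Directional derivatives of matrix-valued maps *)

Section Calculus.
Context {R : realType} {V : normedModType R}.
Implicit Types (p v : V).

Lemma differentiable_mulmxr m k (M : 'M[R]_(m.+1, k.+1))
    (f : V -> 'rV[R]_m.+1) p :
  differentiable f p -> differentiable (fun q => f q *m M) p.
Proof.
move=> df; apply: (differentiable_comp (g := mulmxr M)) => //.
have -> : mulmxr M = \sum_i (fun w : 'rV[R]_m.+1 => w 0 i *: row i M).
  by apply/funext => w; rewrite /= mulmx_sum_row fct_sumE.
apply: differentiable_sum => i; apply: differentiableZl.
exact: differentiable_coord.
Qed.

Lemma is_derive_coord m k (f : V -> 'M[R]_(m.+1, k.+1)) p v df i j :
  is_derive p v f df -> is_derive p v (fun q => f q i j) (df i j).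
Proof.
move=> [dfp <-]; rewrite derive_mx// mxE; apply: DeriveDef => //.
by move/derivable_mxP: dfp.
Qed.

Lemma is_derive_mx m k (f : V -> 'M[R]_(m.+1, k.+1)) p v (df : 'M[R]_(m.+1, k.+1)) :
  (forall i j, is_derive p v (fun q => f q i j) (df i j)) -> is_derive p v f df.
Proof.
move=> H; have dfp : derivable f p v by apply/derivable_mxP => i j; case: (H i j).
apply: DeriveDef => //; rewrite derive_mx//; apply/matrixP => i j; rewrite mxE.
by case: (H i j).
Qed.

(** Serves second covariant derivatives along a frame, whose coefficients vary with the point. *)
Lemma is_derive_scalemx m k (f : V -> R) (g : V -> 'M[R]_(m.+1, k.+1))
    p v df dg :
  is_derive p v f df -> is_derive p v g dg ->
  is_derive p v (fun q => f q *: g q) (df *: g p + f p *: dg).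
Proof.
move=> Df Dg; apply: is_derive_mx => i j.
have Dgij := is_derive_coord i j Dg.
have -> : (fun q => (f q *: g q) i j) = f * (fun q => g q i j).
  by apply/funext => q; rewrite mxE.
apply: is_derive_eq; rewrite !mxE addrC; congr (_ + _).
exact: mulrC.
Qed.

End Calculus.

(** * Derivatives of the parametrization *)

Section ComplexCircleCalculus.
Context {R : realType}.
Variables a b : R.
Implicit Types (p q X v : 'rV[R]_2) (P : 'M[R]_4).

Local Notation phi := (complex_circle a b).

Lemma is_derive_expRN (x : R) : is_derive x 1 (expR \o -%R) (- expR (- x)).
Proof.
rewrite -mulrN1.
exact: (is_derive1_comp (is_derive_expR _) (is_deriveNid x 1)).
Qed.

Lemma is_derive_cosh (x : R) : is_derive x 1 cosh (sinh x).
Proof.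
have D := is_derive_expRN x.
have -> : @cosh R = 2^-1 \*: (expR + (expR \o -%R)).
  by apply/funext => u; exact: mulrC.
by apply: is_derive_eq; rewrite /sinh mulrC.
Qed.

Lemma is_derive_sinh (x : R) : is_derive x 1 sinh (cosh x).
Proof.
have D := is_derive_expRN x.
have -> : @sinh R = 2^-1 \*: (expR - (expR \o -%R)).
  by apply/funext => u; exact: mulrC.
by apply: is_derive_eq; rewrite /cosh opprK mulrC.
Qed.

Lemma cosh2Bsinh2 (x : R) : cosh x ^+ 2 - sinh x ^+ 2 = 1.
Proof.
have e : expR x * expR (- x) = 1 by rewrite -expRD subrr expR0.
by rewrite /cosh /sinh; field: e.
Qed.

Lemma is_diff_comp_coord (g : R -> R) (i : 'I_2) p dg :
  is_derive (p 0 i) 1 g dg ->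
  is_diff p (fun q => g (q 0 i)) (fun v => v 0 i * dg).
Proof.
move=> [/derivable1_diffP gd gE]; have dc := differentiable_coord p 0 i.
apply: DiffDef; first exact: (differentiable_comp dc gd).
apply/funext => v.
rewrite (diff_comp dc gd) /= diff1E// derive1E gE -deriveE//.
by rewrite (derive_val (is_derive := is_derive_coord 0 i (is_derive_id p v))).
Qed.

(** Differentiating [phi] in direction [X] is right multiplication by this constant matrix. *)
Definition circle_gen X : 'M[R]_4 := X 0 0 *: mxJ + X 0 1 *: mxK.

Lemma is_diff_complex_circle_coord p (j : 'I_4) :
  is_diff p (fun q => phi q 0 j) (fun v => (phi p *m circle_gen v) 0 j).
Proof.
have Dc := is_diff_comp_coord (is_derive_cos (p 0 0)).
have Ds := is_diff_comp_coord (is_derive_sin (p 0 0)).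
have DC := is_diff_comp_coord (is_derive_cosh (p 0 1)).
have DS := is_diff_comp_coord (is_derive_sinh (p 0 1)).
set c := (fun q => _) in Dc; set s := (fun q => _) in Ds.
set C := (fun q => _) in DC; set S := (fun q => _) in DS.
have gen v : phi p *m circle_gen v =
    v 0 0 *: (phi p *m mxJ) + v 0 1 *: (phi p *m mxK).
  by rewrite mulmxDr -!scalemxAr.
(* Every coordinate of [phi] is a combination of the four products of cos or sin with cosh or sinh;
   one differential with free coefficients serves all of them. *)
have D (k l m n : R) := is_diffD (is_diffD
  (is_diffM (is_diff_cst k p) (is_diffM Dc DC))
  (is_diffM (is_diff_cst l p) (is_diffM Dc DS))) (is_diffD
  (is_diffM (is_diff_cst m p) (is_diffM Ds DC))
  (is_diffM (is_diff_cst n p) (is_diffM Ds DS))).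
suff [k [l [m [n [phiE dphiE]]]]] : exists k l m n,
    (forall q, phi q 0 j = k * (c q * C q) + l * (c q * S q)
                         + (m * (s q * C q) + n * (s q * S q))) /\
    (forall v, (phi p *m circle_gen v) 0 j =
      k * (c p * (v 0 1 * sinh (p 0 1)) + C p * (v 0 0 * - sin (p 0 0)))
    + l * (c p * (v 0 1 * cosh (p 0 1)) + S p * (v 0 0 * - sin (p 0 0)))
    + (m * (s p * (v 0 1 * sinh (p 0 1)) + C p * (v 0 0 * cos (p 0 0)))
     + n * (s p * (v 0 1 * cosh (p 0 1)) + S p * (v 0 0 * cos (p 0 0))))).
  rewrite (funext phiE).
  refine (is_diff_eq (D k l m n) _).
  by apply/funext => v; rewrite dphiE !scaler0 !addr0.
case: j => [[|[|[|[|//]]]] jlt].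
- exists b, 0, 0, (- a); split=> [q|v].
    by rewrite mxE /= /c /s /C /S; ring.
  by rewrite gen !(mulmxJE, mulmxKE) !mxE /= /c /s /C /S; ring.
- exists 0, a, b, 0; split=> [q|v].
    by rewrite mxE /= /c /s /C /S; ring.
  by rewrite gen !(mulmxJE, mulmxKE) !mxE /= /c /s /C /S; ring.
- exists a, 0, 0, b; split=> [q|v].
    by rewrite mxE /= /c /s /C /S; ring.
  by rewrite gen !(mulmxJE, mulmxKE) !mxE /= /c /s /C /S; ring.
- exists 0, b, (- a), 0; split=> [q|v].
    by rewrite mxE /= /c /s /C /S; ring.
  by rewrite gen !(mulmxJE, mulmxKE) !mxE /= /c /s /C /S; ring.
Qed.

Lemma differentiable_complex_circle p : differentiable phi p.
Proof.
have -> : phi = \sum_j (fun q => phi q 0 j *: delta_mx 0 j).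
  by apply/funext => q; rewrite fct_sumE {1}[phi q]row_sum_delta.
apply: differentiable_sum => j; apply: differentiableZl.
by case: (is_diff_complex_circle_coord p j).
Qed.

Lemma is_derive_complex_circle p X P :
  is_derive p X (fun q => phi q *m P) (phi p *m (circle_gen X *m P)).
Proof.
rewrite mulmxA.
have Dphi : is_derive p X phi (phi p *m circle_gen X).
  apply: is_derive_mx => i j; rewrite ord1.
  have [df dfE] := is_diff_complex_circle_coord p j.
  by apply: DeriveDef; [exact: diff_derivable|rewrite deriveE// dfE].
apply: is_derive_mx => i j; rewrite ord1 mxE.
have -> : (fun q => (phi q *m P) 0 j) = \sum_k (fun q => phi q 0 k) * cst (P k j).
  by apply/funext => q; rewrite mxE fct_sumE.
have H k := is_deriveM (is_derive_coord 0 k Dphi) (is_derive_cst (P k j) p X).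
case: (is_derive_sum H) => dsum dsumE; apply: DeriveDef; first exact: dsum.
rewrite dsumE; apply: eq_bigr => k _.
by rewrite scaler0 add0r [RHS]mulrC.
Qed.

Lemma derive_complex_circle p X P :
  'D_X (fun q => phi q *m P) p = phi p *m (circle_gen X *m P).
Proof. exact: (derive_val (is_derive := is_derive_complex_circle p X P)). Qed.

(** [P] is kept general because a derivative of [phi P] has the same form with another constant
    matrix, which closes the induction. *)
Lemma smooth_complex_circle P : smooth_on setT (fun q => phi q *m P).
Proof.
move=> k; elim: k P => [|k IHk] P.
  move=> p _; apply: differentiable_continuous.
  exact/differentiable_mulmxr/differentiable_complex_circle.
split=> [p _|v]; first exact/differentiable_mulmxr/differentiable_complex_circle.
have -> : 'D_v (fun q => phi q *m P) = fun q => phi q *m (circle_gen v *m P).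
  by apply/funext => q; exact: derive_complex_circle.
exact: IHk.
Qed.

End ComplexCircleCalculus.

(** * Linear algebra at one point x with <x, x> = -1 and <x JK, x> = m *)

Section Quadric.
Context {R : realType}.
Variables (m : R) (x : 'rV[R]_4).
Hypotheses (xx : sdot x x = -1) (xJKx : sdot (x *m mxJ *m mxK) x = m).
Implicit Types X Y : 'rV[R]_2.

(** Adding [m] removes from x JK its component along x, because <x, x> = -1. *)
Definition normal_mx (m : R) : 'M[R]_4 := mxJ *m mxK + m%:M.

Lemma mulmx_gen X : x *m circle_gen X = X 0 0 *: (x *m mxJ) + X 0 1 *: (x *m mxK).
Proof. by rewrite mulmxDr -!scalemxAr. Qed.

Lemma mulmx_normal : x *m normal_mx m = x *m mxJ *m mxK + m *: x.
Proof. by rewrite mulmxDr mulmxA mul_mx_scalar. Qed.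

Lemma circle_gen_sqr X :
  circle_gen X *m circle_gen X =
  (X 0 1 ^+ 2 - X 0 0 ^+ 2)%:M + (2 * X 0 0 * X 0 1) *: (mxJ *m mxK).
Proof.
rewrite /circle_gen mulmxDl !mulmxDr -!scalemxAl -!scalemxAr mxJJ mxKK mxKJ !scalerA.
move: (mxJ *m mxK) => L; apply/matrixP => i j; rewrite !mxE.
by case: eqP => _; rewrite ?mulr1n ?mulr0n; ring.
Qed.

(** From J JK = -K and K JK = J: derivatives of the normal field are tangent to the surface. *)
Lemma mulmx_gen_normal X :
  x *m (circle_gen X *m normal_mx m) =
  (m * X 0 0 + X 0 1) *: (x *m mxJ) + (m * X 0 1 - X 0 0) *: (x *m mxK).
Proof.
rewrite mulmxA mulmx_gen mulmxDr mul_mx_scalar !mulmxDl -!scalemxAl.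
rewrite -!mulmxA [mxK *m (_ *m _)]mulmxA mxKJ [mxJ *m (_ *m _)]mulmxA mxJJ.
rewrite -[mxJ *m _ *m _]mulmxA mxKK mulmx1 mulNmx mul1mx mulmxN.
by rewrite !scalerDr !scalerA; apply/rowP => j; rewrite !mxE; ring.
Qed.

Lemma sdotJx : sdot (x *m mxJ) x = 0.
Proof. by have := sdotJ x x; rewrite [sdot x _]sdotC => h; lra. Qed.

Lemma sdotKx : sdot (x *m mxK) x = 0.
Proof. by have := sdotK x x; rewrite [sdot x _]sdotC => h; lra. Qed.

Lemma sdotJKx : sdot (x *m mxJ) (x *m mxK) = - m.
Proof. by rewrite -xJKx sdotK opprK. Qed.

Lemma sdot_gen X Y :
  sdot (x *m circle_gen X) (x *m circle_gen Y) =
  - (X 0 0 * Y 0 0) - m * (X 0 0 * Y 0 1 + X 0 1 * Y 0 0) + X 0 1 * Y 0 1.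
Proof.
rewrite !mulmx_gen !(sdotDl, sdotDr, sdotZl, sdotZr) sdotJJ sdotKK xx.
by rewrite [sdot (_ *m mxK) _]sdotC sdotJKx; ring.
Qed.

Lemma sdot_gen_l X : sdot (x *m circle_gen X) x = 0.
Proof. by rewrite mulmx_gen sdotDl !sdotZl sdotJx sdotKx; ring. Qed.

Lemma sdot_gen_normal_l X : sdot (x *m (circle_gen X *m normal_mx m)) x = 0.
Proof. by rewrite mulmx_gen_normal sdotDl !sdotZl sdotJx sdotKx; ring. Qed.

Lemma sdot_normal_l : sdot (x *m normal_mx m) x = 0.
Proof. by rewrite mulmx_normal sdotDl sdotZl xx xJKx; ring. Qed.

Lemma sdot_normal : sdot (x *m normal_mx m) (x *m normal_mx m) = 1 + m ^+ 2.
Proof.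
rewrite mulmx_normal !(sdotDl, sdotDr, sdotZl, sdotZr) [sdot x _]sdotC.
by rewrite xJKx xx sdotKK sdotJJ xx; ring.
Qed.

(** As J is an isometry and K an anti-isometry, pairing x JK with x J or x K reduces to pairing x K
    or x J with x, which gives 0. *)
Lemma sdot_normal_gen X : sdot (x *m normal_mx m) (x *m circle_gen X) = 0.
Proof.
rewrite mulmx_normal mulmx_gen !(sdotDl, sdotDr, sdotZl, sdotZr) sdotKK.
rewrite [sdot (x *m _) x]sdotC.
rewrite -mulmxA -mxKJ mulmxA sdotJJ [sdot x (_ *m mxJ)]sdotC [sdot x (_ *m mxK)]sdotC.
by rewrite sdotKx sdotJx; ring.
Qed.

(** Up to sign, the second fundamental form along the normal; only its mixed entry is nonzero. *)
Lemma sdot_gen_normal_gen X Y :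
  sdot (x *m (circle_gen X *m normal_mx m)) (x *m circle_gen Y) =
  - (1 + m ^+ 2) * (X 0 0 * Y 0 1 + X 0 1 * Y 0 0).
Proof.
rewrite mulmx_gen_normal mulmx_gen !(sdotDl, sdotDr, sdotZl, sdotZr).
by rewrite [sdot (_ *m mxK) (_ *m mxJ)]sdotC sdotJKx sdotJJ sdotKK xx; ring.
Qed.

(** Orthogonal projection onto the tangent space of the quadric; the plus sign reflects <x, x> =
    -1. *)
Definition tanproj (u : 'rV[R]_4) : 'rV[R]_4 := u + sdot u x *: x.

Lemma tanprojD u v : tanproj (u + v) = tanproj u + tanproj v.
Proof. by rewrite /tanproj sdotDl scalerDl addrACA. Qed.

Lemma tanprojZ c u : tanproj (c *: u) = c *: tanproj u.
Proof. by rewrite /tanproj sdotZl scalerDr scalerA. Qed.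

Lemma tanproj_id u : sdot u x = 0 -> tanproj u = u.
Proof. by move=> ux; rewrite /tanproj ux scale0r addr0. Qed.

Lemma tanproj_sum (I : Type) (r : seq I) (F : I -> 'rV[R]_4) :
  tanproj (\sum_(i <- r) F i) = \sum_(i <- r) tanproj (F i).
Proof.
elim/big_rec2: _ => [|i u v _ <-]; last by rewrite tanprojD.
by rewrite tanproj_id ?sdot0l.
Qed.

(** Here 1 - m JK = (1 + m^2) - m N with N = [normal_mx m]; the projection kills multiples of x and
    fixes x N. *)
Lemma tanproj_hess_id :
  tanproj (x *m (1%:M - m *: (mxJ *m mxK))) = - m *: (x *m normal_mx m).
Proof.
rewrite mulmxBr mulmx1 -scalemxAr mulmxA mulmx_normal /tanproj.
rewrite -scaleN1r sdotDl !sdotZl xx xJKx.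
by apply/rowP => j; rewrite !mxE; ring.
Qed.

(** As (JK)^2 = -1, the matrix product is (1 - m^2) JK + 2m, which differs from (1 - m^2) N by a
    scalar. *)
Lemma tanproj_hess_normal :
  tanproj (x *m ((1%:M - m *: (mxJ *m mxK)) *m normal_mx m)) =
  (1 - m ^+ 2) *: (x *m normal_mx m).
Proof.
have LL : mxJ *m mxK *m (mxJ *m mxK) = - 1%:M :> 'M[R]_4.
  by rewrite -{2}mxKJ mulmxA -[mxJ *m _ *m _]mulmxA mxKK mulmx1 mxJJ.
have -> : (1%:M - m *: (mxJ *m mxK)) *m normal_mx m =
    (1 - m ^+ 2) *: (mxJ *m mxK) + (2 * m)%:M :> 'M[R]_4.
  rewrite mulmxBl mul1mx -scalemxAl [in X in _ - X]mulmxDr LL mul_mx_scalar.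
  rewrite /normal_mx; move: (mxJ *m mxK) => L; apply/matrixP => i j.
  by rewrite !mxE; case: eqP => _; rewrite ?mulr1n ?mulr0n; ring.
rewrite mulmxDr mul_mx_scalar -scalemxAr mulmxA mulmx_normal /tanproj.
rewrite sdotDl !sdotZl xx xJKx.
by apply/rowP => j; rewrite !mxE; ring.
Qed.

End Quadric.

(** * Induced metric and connections of the complex circle *)

Section ComplexCircle.
Context {R : realType}.
Variables a b : R.
Hypothesis hab : b ^+ 2 - a ^+ 2 = 1.
Implicit Types (p q X Y : 'rV[R]_2) (P : 'M[R]_4) (V W : 'rV[R]_2 -> 'rV[R]_4).

Local Notation phi := (complex_circle a b).
Local Notation m := (2 * a * b).
Local Notation D := (1 + m ^+ 2).
Local Notation N := (normal_mx m).

Lemma sdot_phi p : sdot (phi p) (phi p) = -1.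
Proof.
rewrite sdotE !mxE /=.
have cs := cos2Dsin2 (p 0 0); have CS := cosh2Bsinh2 (p 0 1).
move: (cos _) (sin _) (cosh _) (sinh _) cs CS => c s C S cs CS.
(* Inserting factors equal to 1 makes both sides homogeneous, so that a polynomial identity
   remains. *)
rewrite -hab -[RHS]mulr1 -[in RHS]CS -[RHS]mulr1 -[in RHS]cs.
by ring.
Qed.

Lemma sdot_phi_JK p : sdot (phi p *m mxJ *m mxK) (phi p) = m.
Proof.
rewrite mulmxKE mulmxJE sdotE !mxE /=.
have cs := cos2Dsin2 (p 0 0); have CS := cosh2Bsinh2 (p 0 1).
move: (cos _) (sin _) (cosh _) (sinh _) cs CS => c s C S cs CS.
transitivity (m * (C ^+ 2 - S ^+ 2) * (c ^+ 2 + s ^+ 2)); first by ring.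
by rewrite CS cs !mulr1.
Qed.

Lemma gram_det_gt0 : 0 < D.
Proof. by rewrite ltr_wpDr ?sqr_ge0. Qed.

Lemma gram_det_neq0 : D != 0.
Proof. by rewrite gt_eqF ?gram_det_gt0. Qed.

Lemma dphiE p X : dphi phi p X = phi p *m circle_gen X.
Proof.
rewrite /dphi -[circle_gen X]mulmx1 -derive_complex_circle.
by congr ('D_X _ p); apply/funext => q; rewrite mulmx1.
Qed.

Lemma metricE p X Y : metric phi p X Y =
  - (X 0 0 * Y 0 0) - m * (X 0 0 * Y 0 1 + X 0 1 * Y 0 0) + X 0 1 * Y 0 1.
Proof.
by rewrite /metric !dphiE (sdot_gen (sdot_phi p) (sdot_phi_JK p)).
Qed.

Lemma lorentzian_complex_circle : lorentzian_surface_in_H31 phi.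
Proof.
split.
- have -> : phi = fun q => phi q *m 1%:M by apply/funext => q; rewrite mulmx1.
  exact: smooth_complex_circle.
- exact: sdot_phi.
(* The s-direction is already unit timelike; [w] is the t-direction made orthogonal to it and
   normalized, its squared length being [D]. *)
- move=> p; pose w : 'rV[R]_2 := (Num.sqrt D)^-1 *: (delta_mx 0 1 - m *: delta_mx 0 0).
  exists (delta_mx 0 0), w; rewrite !metricE /w !mxE /=.
  have s2 : Num.sqrt D ^+ 2 = D by rewrite sqr_sqrtr// ltW// gram_det_gt0.
  have s0 : Num.sqrt D != 0 by rewrite gt_eqF// sqrtr_gt0 gram_det_gt0.
  split; [by ring| |by ring].
  by field: s2.
Qed.

Definition circle_gram : 'M[R]_2 := \matrix_(i, j)
  (if i == j then (if i == 0 then -1 else 1) else - m).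

Lemma gramE p : gram phi p = circle_gram.
Proof.
apply/matrixP => i j; rewrite !mxE metricE !mxE.
by case: i => [[|[|//]] ?]; case: j => [[|[|//]] ?] /=; ring.
Qed.

(** An instance of Cayley-Hamilton: the trace is 0 and the determinant is -D. It yields the
    inverse. *)
Lemma circle_gram_sqr : circle_gram *m circle_gram = D%:M.
Proof.
apply/matrixP => i j; rewrite !mxE !big_ord_recl big_ord0 !mxE /=.
case: i => [[|[|//]] ?]; case: j => [[|[|//]] ?] /=; rewrite ?mulr1n ?mulr0n.
all: by ring.
Qed.

Lemma invmx_gram p : invmx (gram phi p) = D^-1 *: circle_gram.
Proof.
rewrite gramE; have gg : circle_gram *m (D^-1 *: circle_gram) = 1%:M.
  by rewrite -scalemxAr circle_gram_sqr scale_scalar_mx mulVf// gram_det_neq0.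
by rewrite -[LHS]mulmx1 -gg mulKmx//; case: (mulmx1_unit gg).
Qed.

(** A constant Gram matrix has vanishing Christoffel symbols. *)
Lemma nablaME X (Y : 'rV[R]_2 -> 'rV[R]_2) p : nablaM phi X Y p = 'D_X Y p.
Proof.
have christoffel0 i j k : christoffel phi p i j k = 0.
  have dg v i' j' : 'D_v (fun q => gram phi q i' j') p = 0.
    have -> : (fun q => gram phi q i' j') = cst (circle_gram i' j').
      by apply/funext => q; rewrite gramE.
    exact: derive_cst.
  rewrite /christoffel big1 ?mulr0// => l _.
  by rewrite !dg addr0 subr0 mulr0.
rewrite /nablaM -[RHS]addr0; congr (_ + _); apply/rowP => k; rewrite !mxE.
by rewrite big1// => i _; rewrite big1// => j _; rewrite christoffel0 !mul0r.
Qed.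

(** Needed because explicit formulas for sections hold only on the open set carrying the frame. *)
Lemma eq_nabla X V W p : {near p, V =1 W} -> nabla phi X V p = nabla phi X W p.
Proof. by move=> VW; rewrite /nabla (near_eq_derive _ VW). Qed.

Lemma nabla_mulmx X P p :
  nabla phi X (fun q => phi q *m P) p = tanproj (phi p) (phi p *m (circle_gen X *m P)).
Proof. by rewrite /nabla derive_complex_circle. Qed.

Lemma dphi_nabla p X : dphi phi p X = nabla phi X phi p.
Proof. by rewrite /nabla -/(dphi phi p X) dphiE sdot_gen_l scale0r addr0. Qed.

(** * Rough Laplacian and tension field in an orthonormal frame *)

Section Frame.
Variables (U : set 'rV[R]_2) (eps : 'I_2 -> R) (e : 'I_2 -> 'rV[R]_2 -> 'rV[R]_2).
Hypotheses (openU : open U) (frame : orthonormal_frame phi eps e U).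

Lemma eps_sqr i : eps i * eps i = 1.
Proof. by case: frame => /(_ i)[] -> _ _; ring. Qed.

Lemma derivable_frame i p v : U p -> derivable (e i) p v.
Proof. by case: frame => _ /(_ i 1%N)[d _] _ Up; exact/diff_derivable/d. Qed.

(** For every orthonormal frame the sum of eps_i e_i tensor e_i is the inverse metric; this
    eliminates the frame from all traces. *)
Lemma frame_gram p : U p ->
  [/\ \sum_i eps i * e i p 0 0 ^+ 2 = - D^-1,
      \sum_i eps i * (e i p 0 0 * e i p 0 1) = - m / D &
      \sum_i eps i * e i p 0 1 ^+ 2 = D^-1].
Proof.
move=> Up; case: (frame) => _ _ /(_ p _ _ Up) onb.
pose E : 'M[R]_2 := \matrix_(i, j) e i p 0 j.
pose A : 'M[R]_2 := \matrix_(i, j) (eps i * E i j).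
have AgE : A *m circle_gram *m E^T = 1%:M.
  apply/matrixP => i j; rewrite !mxE.
  transitivity (eps i * metric phi p (e i p) (e j p)).
    rewrite metricE sum2E !mxE !sum2E !mxE /=.
    by ring.
  by rewrite onb; case: eqP => _; rewrite ?mulr0// eps_sqr.
(* A one-sided inverse of a square matrix is two-sided, so the factors of [AgE] can be rotated. *)
have EA : E^T *m A = D^-1 *: circle_gram.
  have := mulmx1C AgE => /(congr1 (mulmx^~ (D^-1 *: circle_gram))).
  rewrite mul1mx -scalemxAr -!mulmxA circle_gram_sqr !mul_mx_scalar -scalemxAr.
  by rewrite scalerA mulVf ?gram_det_neq0// scale1r.
have EAE k l : \sum_i eps i * (e i p 0 k * e i p 0 l) = (D^-1 *: circle_gram) k l.
  rewrite -EA mxE; apply: eq_bigr => i _; rewrite !mxE.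
  by ring.
split.
- by rewrite (EAE 0 0) !mxE /= mulrN1.
- by rewrite (EAE 0 1) !mxE /= mulrC.
- by rewrite (EAE 1 1) !mxE /= mulr1.
Qed.

(** The last hypothesis says that first derivatives of [phi P] need no projection, so a second
    covariant derivative involves only one. *)
Lemma rough_laplacian_mulmx V P p : U p ->
  (forall q, U q -> V q = phi q *m P) ->
  (forall X q, sdot (phi q *m (circle_gen X *m P)) (phi q) = 0) ->
  rough_laplacian phi eps e V p =
  - (2 / D) *: tanproj (phi p) (phi p *m ((1%:M - m *: (mxJ *m mxK)) *m P)).
Proof.
move=> Up VE Pphi.
have nearU : \forall q \near p, U q by exact: open_nbhs_nbhs.
have nablaV X q : U q -> nabla phi X V q = phi q *m (circle_gen X *m P).
  move=> Uq; rewrite (@eq_nabla _ _ (fun q => phi q *m P)); last first.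
    by near=> q'; apply: VE; near: q'; exact: open_nbhs_nbhs.
  by rewrite nabla_mulmx tanproj_id.
(* The derivative of the frame field occurs in both terms and cancels. *)
have nabla2 i : nabla phi (e i p) (fun q => nabla phi (e i q) V q) p
      - nabla phi (nablaM phi (e i p) (e i) p) V p =
    tanproj (phi p) (phi p *m (circle_gen (e i p) *m circle_gen (e i p) *m P)).
  set X := e i p.
  rewrite (@eq_nabla _ _ (fun q => e i q 0 0 *: (phi q *m (mxJ *m P))
                                + e i q 0 1 *: (phi q *m (mxK *m P)))); last first.
    near=> q; rewrite nablaV; last by near: q.
    by rewrite mulmxDl mulmxDr -!scalemxAl -!scalemxAr.
  have De : is_derive p X (e i) ('D_X (e i) p) by apply/derivableP/derivable_frame.
  have De0 := is_derive_coord 0 0 De; have De1 := is_derive_coord 0 1 De.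
  have DV := is_deriveD
    (is_derive_scalemx De0 (is_derive_complex_circle a b p X (mxJ *m P)))
    (is_derive_scalemx De1 (is_derive_complex_circle a b p X (mxK *m P))).
  rewrite nablaV// nablaME /nabla (derive_val (is_derive := DV)).
  rewrite -/(tanproj (phi p) _) addrACA tanprojD.
  set u := _ *: _ + _ *: _; have -> : u = phi p *m (circle_gen ('D_X (e i) p) *m P).
    by rewrite /u mulmxDl mulmxDr -!scalemxAl -!scalemxAr.
  rewrite tanproj_id// addrAC subrr add0r; congr tanproj.
  have gP : circle_gen X *m P = X 0 0 *: (mxJ *m P) + X 0 1 *: (mxK *m P).
    by rewrite mulmxDl -!scalemxAl.
  by rewrite -[in RHS]mulmxA gP !mulmxDr -!scalemxAr.
have [f00 f01 f11] := frame_gram Up.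
have s1 : \sum_i eps i * (e i p 0 1 ^+ 2 - e i p 0 0 ^+ 2) = 2 / D.
  under eq_bigr do rewrite mulrBr.
  by rewrite sumrB f00 f11; ring.
have s2 : \sum_i eps i * (2 * e i p 0 0 * e i p 0 1) = 2 / D * - m.
  under eq_bigr do rewrite -mulrA mulrCA.
  by rewrite -mulr_sumr f01; ring.
have sum_gen : \sum_i eps i *: (circle_gen (e i p) *m circle_gen (e i p)) =
    (2 / D) *: (1%:M - m *: (mxJ *m mxK)).
  under eq_bigr do rewrite circle_gen_sqr scalerDr scale_scalar_mx scalerA.
  rewrite big_split /= -scaler_suml -raddf_sum s1 s2 scalerDr scale_scalar_mx mulr1.
  by rewrite mulrN scaleNr scalerN scalerA.
rewrite /rough_laplacian; under eq_bigr do rewrite nabla2 -tanprojZ scalemxAr scalemxAl.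
rewrite -tanproj_sum -mulmx_sumr -mulmx_suml sum_gen -scalemxAl -scalemxAr.
by rewrite tanprojZ scaleNr.
Unshelve. all: by end_near. Qed.

Lemma sdot_gen_normal c X p :
  sdot (phi p *m (circle_gen X *m (c *: N))) (phi p) = 0.
Proof.
by rewrite -!scalemxAr sdotZl sdot_gen_normal_l mulr0.
Qed.

Lemma tensionE p : U p -> tension phi eps e p = phi p *m (- (2 * m / D) *: N).
Proof.
(* [nabla] applies to any R^4-valued map, so the position vector [phi] can stand for a section, and
   its covariant derivative is [dphi]. *)
move=> Up; have -> : tension phi eps e p = - rough_laplacian phi eps e phi p.
  rewrite /rough_laplacian opprK; apply: eq_bigr => i _.
  have -> : (fun q => dphi phi q (e i q)) = (fun q => nabla phi (e i q) phi q).
    by apply/funext => q; rewrite dphi_nabla.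
  by rewrite dphi_nabla.
rewrite (@rough_laplacian_mulmx _ 1%:M)//.
- rewrite mulmx1 (tanproj_hess_id (sdot_phi p) (sdot_phi_JK p)) -scalemxAr.
  by rewrite scaleNr opprK scalerA; congr (_ *: _); ring.
- by move=> q _; rewrite mulmx1.
- by move=> X q; rewrite mulmx1 sdot_gen_l.
Qed.

Lemma lap_tensionE k p : U p ->
  lap_tension phi eps e k p =
  phi p *m ((- (2 * m / D) * (2 * (m ^+ 2 - 1) / D) ^+ k) *: N).
Proof.
elim: k p => [|k IHk] p Up; first by rewrite expr0 mulr1 -tensionE.
(* The induction hypothesis is used on all of [U], since the Laplacian differentiates the previous
   iterate. *)
rewrite /lap_tension iterS (rough_laplacian_mulmx Up IHk) => [|X q]; last first.
  exact: sdot_gen_normal.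
rewrite -!scalemxAr tanprojZ (tanproj_hess_normal (sdot_phi p) (sdot_phi_JK p)).
by rewrite !scalerA; congr (_ *: _); rewrite [_ ^+ k.+1]exprS; ring.
Qed.

Lemma nabla_lap_tension k X p : U p ->
  nabla phi X (lap_tension phi eps e k) p =
  phi p *m (circle_gen X *m
    ((- (2 * m / D) * (2 * (m ^+ 2 - 1) / D) ^+ k) *: N)).
Proof.
move=> Up; rewrite (@eq_nabla _ _ (fun q => phi q *m
  ((- (2 * m / D) * (2 * (m ^+ 2 - 1) / D) ^+ k) *: N))).
  by rewrite nabla_mulmx tanproj_id// sdot_gen_normal.
have : \forall q \near p, U q by exact: open_nbhs_nbhs.
by apply: filterS => q; exact: lap_tensionE.
Qed.

(** * Curvature terms and vanishing of tau_r *)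

Lemma sdot_normal_dphi c X p : sdot (phi p *m (c *: N)) (dphi phi p X) = 0.
Proof.
by rewrite dphiE -scalemxAr sdotZl sdot_normal_gen mulr0.
Qed.

(** Each of the two frame vectors contributes minus the normal vector, as eps_i <e_i, e_i> = 1. *)
Lemma sum_curvH_normal c p : U p ->
  \sum_i eps i *: curvH (phi p *m (c *: N)) (dphi phi p (e i p)) (dphi phi p (e i p))
  = - 2 *: (phi p *m (c *: N)).
Proof.
move=> Up; have [_ _ onb] := frame; rewrite sum2E.
have curvE i : eps i *: curvH (phi p *m (c *: N)) (dphi phi p (e i p))
    (dphi phi p (e i p)) = - (phi p *m (c *: N)).
  rewrite /curvH sdot_normal_dphi scale0r subr0 scalerN scalerA.
  by rewrite -/(metric phi p _ _) onb// eqxx eps_sqr scale1r.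
by rewrite !curvE -opprD scaleNr scaler_nat.
Qed.

(** Normality leaves one curvature term, whose coefficient is a trace of the second fundamental
    form. *)
Lemma sum_curvH_nabla c p : U p ->
  \sum_i eps i *: curvH (phi p *m (circle_gen (e i p) *m (c *: N)))
                        (phi p *m (c *: N)) (dphi phi p (e i p))
  = (2 * c * m) *: (phi p *m (c *: N)).
Proof.
move=> Up; have [_ f01 _] := frame_gram Up.
under eq_bigr => i _.
  rewrite /curvH sdot_normal_dphi scale0r sub0r opprK dphiE -!scalemxAr sdotZl.
  rewrite (sdot_gen_normal_gen (sdot_phi p) (sdot_phi_JK p)) scalerA.
  rewrite (_ : _ * _ = eps i * (e i p 0 0 * e i p 0 1) * (- (2 * c * D))); last by ring.
  over.
rewrite -scaler_suml -mulr_suml f01 -scalemxAr; congr (_ *: _).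
by field; exact: gram_det_neq0.
Qed.

Lemma curvH0l (Y Z : 'rV[R]_4) : curvH 0 Y Z = 0.
Proof. by rewrite /curvH sdot0l scaler0 scale0r subr0 oppr0. Qed.

Lemma tau_eq0_of_sqr1 r p : U p -> (3 < r)%N -> m ^+ 2 = 1 -> tau phi eps e r p = 0.
Proof.
move=> Up r3 m1.
(* The eigenvalue is 0, but 0^0 = 1 keeps the tension field itself, whence k > 0. *)
have L0 k : (0 < k)%N -> lap_tension phi eps e k p = 0.
  by move=> k0; rewrite lap_tensionE// m1 subrr mulr0 mul0r expr0n gtn_eqF// mulr0
    scale0r mulmx0.
have dL0 k X : (0 < k)%N -> nabla phi X (lap_tension phi eps e k) p = 0.
  by move=> k0; rewrite nabla_lap_tension// m1 subrr mulr0 mul0r expr0n gtn_eqF// mulr0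
    scale0r !mulmx0.
(* [Y] is arbitrary because the second argument may involve the tension field (l = s - 1); the first
   always has positive index. *)
have sumL0 k (Y : 'I_2 -> 'rV[R]_4) : (0 < k)%N ->
    \sum_i eps i *: curvH (lap_tension phi eps e k p) (Y i) (dphi phi p (e i p)) = 0.
  by move=> k0; rewrite big1// => i _; rewrite L0// curvH0l scaler0.
have sumdL0 k (Y : 'I_2 -> 'rV[R]_4) : (0 < k)%N ->
    \sum_i eps i *: curvH (nabla phi (e i p) (lap_tension phi eps e k) p) (Y i)
                          (dphi phi p (e i p)) = 0.
  by move=> k0; rewrite big1// => i _; rewrite dL0// curvH0l scaler0.
(* With [r./2] equal to 1, the last term of [tau_odd] would involve only the tension field and its
   derivative. *)
have s2 : (1 < r./2)%N by lia.
rewrite /tau; case: ifP => _.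
- have [s1 s3 s4] : [/\ 0 < 2 * r./2, 0 < 2 * r./2 - 1 & 0 < r./2 - 1]%N by split; lia.
  rewrite /tau_odd L0// sumL0// sumdL0// !subr0 sub0r big_nat big1 ?oppr0//.
  move=> l /andP[l1 ls]; have sl : (0 < r./2 + l - 1)%N by lia.
  by rewrite sumdL0// sumL0// subr0.
- have [s1 s3] : (0 < 2 * r./2 - 1)%N /\ (0 < 2 * r./2 - 2)%N by lia.
  rewrite /tau_even L0// sumL0// subr0 sub0r big_nat big1 ?oppr0//.
  move=> l /andP[l1 ls]; have sl : (0 < r./2 + l - 2)%N by lia.
  by rewrite sumdL0// sumL0// subr0.
Qed.

Lemma tau3_eq0 p : U p -> m ^+ 2 = 3^-1 -> tau phi eps e 3 p = 0.
Proof.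
(* Here s = 1, so the sum over l is empty. *)
move=> Up m3; rewrite /tau /= /tau_odd big_geq// subr0.
under [X in _ - _ - X]eq_bigr do rewrite nabla_lap_tension ?lap_tensionE//.
rewrite !lap_tensionE// sum_curvH_normal// sum_curvH_nabla//.
rewrite -!scalemxAr !scalerA -!scalerBl.
rewrite [X in X *: _](_ : _ = 0) ?scale0r//.
have -> : 2 * (m ^+ 2 - 1) / D = -1 by rewrite m3; field.
rewrite muln1 subn1 subnn sqrrN !expr1n.
transitivity (- (2 * m / D) * (4 * m ^+ 2 / D - 1)); first by ring.
by rewrite m3 [X in X - 1](_ : _ = 1) ?subrr ?mulr0//; field.
Qed.

End Frame.

(** * Non-minimality *)

Lemma not_minimal_complex_circle : m != 0 -> ~ minimal phi.
Proof.
move=> m0 /(_ setT (fun q => phi q *m ((Num.sqrt D)^-1 *: N)) 1 openT) min0.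
have s2 : Num.sqrt D ^+ 2 = D by rewrite sqr_sqrtr// ltW// gram_det_gt0.
have s0 : Num.sqrt D != 0 by rewrite gt_eqF// sqrtr_gt0 gram_det_gt0.
have : mean_curvature phi (fun q => phi q *m ((Num.sqrt D)^-1 *: N)) 1 0 = 0.
  apply: min0 => //; split; [exact: smooth_complex_circle|by left|move=> p _].
  split=> [|X|]; first 1 last.
  - exact: sdot_normal_dphi.
  - rewrite -scalemxAr sdotZl sdotZr (sdot_normal (sdot_phi p) (sdot_phi_JK p)).
    by rewrite mulrA -invfM -expr2 s2 mulVf// gram_det_neq0.
  - by rewrite -scalemxAr sdotZl (sdot_normal_l (sdot_phi p) (sdot_phi_JK p)) mulr0.
set eta := fun q => _.
have nablaE i j : sdot (- nabla phi (basis_vec i) eta 0) (dphi phi 0 (basis_vec j)) =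
    (Num.sqrt D)^-1 * D * (i != j)%:R.
  rewrite /eta nabla_mulmx tanproj_id ?sdot_gen_normal// dphiE -!scalemxAr.
  rewrite sdotNl sdotZl (sdot_gen_normal_gen (sdot_phi 0) (sdot_phi_JK 0)) !mxE.
  by case: i => [[|[|//]] ?]; case: j => [[|[|//]] ?] /=; ring.
(* The second fundamental form is off-diagonal, so the diagonal of the shape operator comes from the
   entry -m / D of the inverse Gram matrix. *)
have shapeE i : shape_operator phi eta 0 i i = - m / Num.sqrt D.
  rewrite /shape_operator mxE /tangent_coords invmx_gram mxE.
  transitivity (\sum_j (Num.sqrt D)^-1 * D * (i != j)%:R * (D^-1 * circle_gram j i)).
    by apply: eq_bigr => j _; rewrite [X in X * _]mxE nablaE [X in _ * X]mxE.
  rewrite sum2E !mxE.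
  case: i => [[|[|//]] ?] /=; field; rewrite s0 gram_det_neq0//.
have -> : mean_curvature phi eta 1 0 = - m / Num.sqrt D.
  rewrite /mean_curvature /mxtrace (eq_bigr _ (fun i _ => shapeE i)) sum2E.
  by field.
by apply/eqP; rewrite mulf_neq0 ?invr_eq0// oppr_eq0.
Qed.

End ComplexCircle.

(* The source states case (1) for every r > 2; for r = 3 the values of a, b in
   case (1) give tau_3 = 4 f^2 tau <> 0, so r = 3 has to be excluded there. *)
Theorem theorem3p18 (R : realType) (a b : R) (r : nat)
    (hab : b ^+ 2 - a ^+ 2 = 1) (hab0 : a * b != 0)
    (hcase :
      ((2 < r)%N /\ r <> 3%N /\
       a ^+ 2 = Num.sqrt 2 / 2 - 1 / 2 /\ b ^+ 2 = Num.sqrt 2 / 2 + 1 / 2)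
      \/
      (r = 3%N /\
       a ^+ 2 = Num.sqrt 3 / 3 - 1 / 2 /\ b ^+ 2 = Num.sqrt 3 / 3 + 1 / 2)) :
  lorentzian_surface_in_H31 (complex_circle a b) /\
  proper_r_harmonic (complex_circle a b) r.
Proof.
split; first exact: lorentzian_complex_circle.
have m0 : 2 * a * b != 0 by rewrite -mulrA mulf_neq0.
split; last exact: not_minimal_complex_circle.
have m2E : (2 * a * b) ^+ 2 = 4 * a ^+ 2 * b ^+ 2 by ring.
have s2 : Num.sqrt 2 ^+ 2 = 2 :> R by rewrite sqr_sqrtr.
have s3 : Num.sqrt 3 ^+ 2 = 3 :> R by rewrite sqr_sqrtr.
move=> U eps e openU frame p Up.
case: hcase => [[r2 [r3 [a2 b2]]]|[-> [a2 b2]]].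
(* Here m^2 = 4 (1/2 - 1/4) = 1. *)
- apply: (tau_eq0_of_sqr1 hab openU frame Up); first by lia.
  by rewrite m2E a2 b2; field: s2.
(* Here m^2 = 4 (1/3 - 1/4) = 1/3. *)
- apply: (tau3_eq0 hab openU frame Up).
  by rewrite m2E a2 b2; field: s3.
Qed.
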